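(* Let $\mathbf E=(E,+,{}',0,1)$ be an effect algebra with induced order $\leq$ and put $x\odot y:=(x'+y')'$, defined if and only if $x'\leq y$, and $x\rightarrow y:=x'+L(x,y)$ for $x,y\in E$. Then $(E,\leq,\odot,\rightarrow,{}',0,1)$ is a divisible strict unsharp residuated poset.
   Context: An effect algebra is a partial algebra $(E,+,{}',0,1)$ of type $(2,1,0,0)$ where $+$ is a partial binary operation such that for all $x,y,z\in E$: (E1) $x+y$ is defined iff $y+x$ is defined, and then $x+y=y+x$; (E2) $(x+y)+z$ is defined iff $x+(y+z)$ is defined, and then they are equal; (E3) $x'$ is the unique $u\in E$ with $x+u=1$; (E4) if $1+x$ is defined then $x=0$. The induced order is $x\leq y$ iff $x+z=y$ for some $z$; $x+y$ is defined iff $x\leq y'$; for a set $A$ with $u\leq x'$ for all $u\in A$, $x+A=\{x+u\mid u\in A\}$. In a poset, $L(A)$, $U(A)$ are the sets of lower, resp. upper, bounds of $A$; $L(x,y)=L(\{x,y\})$, $UL(A)=U(L(A))$, etc. A partial commutative monoid $(C,\odot,1)$: $\odot$ partial binary, $(x\odot y)\odot z$ defined iff $x\odot(y\odot z)$ defined and then equal, $x\odot 1=1\odot x=x$, $x\odot y$ defined iff $y\odot x$ defined and then equal. For $A\subseteq C$ and $y$ with $A\odot y$ defined elementwise, $A\odot y=\{a\odot y\mid a\in A\}$; $A'=\{a'\mid a\in A\}$. A strict unsharp residuated poset is $(C,\leq,\odot,\rightarrow,{}',0,1)$ with $\rightarrow:C^2\to 2^C$ such that for all $x,y,z\in C$: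 (C1) $(C,\leq,{}',0,1)$ is a bounded poset with an antitone involution $'$; (C2) $(C,\odot,1)$ is a partial commutative monoid in which $x\odot y$ is defined iff $x'\leq y$; moreover $z'\leq x\leq y$ implies $x\odot z\leq y\odot z$, and $x\leq y$ implies $x=y\odot(y\odot x')'$; (C3) $U(x,y')\odot y\subseteq UL(y,z)$ iff $U(x,y')\subseteq U(y\rightarrow z)$; (C4) $x\rightarrow 0=\{x'\}$. It is divisible if moreover (C5) $x\odot(x\rightarrow y)=L(x,y)$ for all $x,y$ (with $x\odot A=\{x\odot a\mid a\in A\}$). *)

(* Defs.v *)
From mathcomp Require Import all_boot.
From mathcomp Require Import boolp classical_sets.
From Corelib Require Relation_Definitions.

Set Implicit Arguments.
Unset Strict Implicit.
Unset Printing Implicit Defensive.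

Local Open Scope classical_set_scope.

(* A partial binary operation on T is a map T -> T -> option T, with None for
   "undefined"; an equation between options thus says that both sides are
   defined simultaneously and are then equal. *)

Section PartialOperations.
Variable T : Type.
Implicit Types (op : T -> T -> option T) (f : T -> option T) (A : set T).

Definition partial_commutative op : Prop := forall x y, op x y = op y x.

Definition partial_associative op : Prop := forall x y z,
  obind (fun s => op s z) (op x y) = obind (fun s => op x s) (op y z).

Definition defined_on f A : Prop := forall a, A a -> isSome (f a).

(* Elementwise image, such as x + A for f := add x; only meaningful when
   [defined_on f A], since undefined values are dropped. *)
Definition pimage f A : set T := [set w | exists2 a, A a & f a = Some w].

End PartialOperations.

Section Bounds.
Variables (T : Type) (le : T -> T -> Prop).

Definition lower (A : set T) : set T := [set w | forall a, A a -> le w a].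

Definition upper (A : set T) : set T := [set w | forall a, A a -> le a w].

End Bounds.

Record effect_algebra (E : Type) (add : E -> E -> option E) (compl : E -> E)
    (zero one : E) : Prop := EffectAlgebra {
  ea_comm : partial_commutative add;
  ea_assoc : partial_associative add;
  ea_compl : forall x, unique (fun u => add x u = Some one) (compl x);
  ea_one : forall x, isSome (add one x) -> x = zero
}.

Record bounded_involution_poset (C : Type) (le : C -> C -> Prop)
    (compl : C -> C) (zero one : C) : Prop := BoundedInvolutionPoset {
  bip_order : Relation_Definitions.order C le;
  bip_zero : forall x, le zero x;
  bip_one : forall x, le x one;
  bip_antitone : forall x y, le x y -> le (compl y) (compl x);
  bip_involutive : involutive compl
}.

Record partial_commutative_monoid (C : Type) (odot : C -> C -> option C)
    (one : C) : Prop := PartialCommutativeMonoid {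
  pcm_assoc : partial_associative odot;
  pcm_unitr : forall x, odot x one = Some x;
  pcm_unitl : forall x, odot one x = Some x;
  pcm_comm : partial_commutative odot
}.

Record strict_unsharp_residuated_poset (C : Type) (le : C -> C -> Prop)
    (odot : C -> C -> option C) (imp : C -> C -> set C) (compl : C -> C)
    (zero one : C) : Prop := StrictUnsharpResiduatedPoset {
  surp_poset : bounded_involution_poset le compl zero one;
  surp_monoid : partial_commutative_monoid odot one;
  surp_defined : forall x y, isSome (odot x y) <-> le (compl x) y;
  surp_monotone : forall x y z, le (compl z) x -> le x y ->
    exists u v, [/\ odot x z = Some u, odot y z = Some v & le u v];
  surp_sectional : forall x y, le x y ->
    obind (fun w => odot y (compl w)) (odot y (compl x)) = Some x;
  (* odot ^~ y is defined on the upper bounds of compl y by surp_defined *)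
  surp_adjoint : forall x y z,
    pimage (odot ^~ y) (upper le [set x; compl y])
      `<=` upper le (lower le [set y; z])
    <-> upper le [set x; compl y] `<=` upper le (imp y z);
  surp_imp0 : forall x, imp x zero = [set compl x]
}.

Record divisible_strict_unsharp_residuated_poset (C : Type)
    (le : C -> C -> Prop) (odot : C -> C -> option C) (imp : C -> C -> set C)
    (compl : C -> C) (zero one : C) : Prop :=
  DivisibleStrictUnsharpResiduatedPoset {
  dsurp_surp : strict_unsharp_residuated_poset le odot imp compl zero one;
  dsurp_defined : forall x y, defined_on (odot x) (imp x y);
  dsurp_divisible : forall x y,
    pimage (odot x) (imp x y) = lower le [set x; y]
}.

Section EffectAlgebraOperations.
Variables (E : Type) (add : E -> E -> option E) (compl : E -> E).

Definition ea_le (x y : E) : Prop := exists z, add x z = Some y.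

Definition ea_odot (x y : E) : option E :=
  omap compl (add (compl x) (compl y)).

(* In an effect algebra compl x + u is defined for every u in L(x, y), since
   u <= x = compl (compl x). *)
Definition ea_imp (x y : E) : set E :=
  pimage (add (compl x)) (lower ea_le [set x; y]).

End EffectAlgebraOperations.

(* Main.v *)
Require Import Defs.
From mathcomp Require Import all_boot.
From mathcomp Require Import boolp classical_sets.

Set Implicit Arguments.
Unset Strict Implicit.
Unset Printing Implicit Defensive.

(** In an effect algebra [x + y = s] is equivalent to [x + s' = y'].  Hence
    [a ⊙ y = w] means [y' + w = a]: multiplying by [y] and adding [y'] are
    mutually inverse bijections between [[y', 1]] and [[0, y]].  By cancellation
    both preserve the order, which gives adjointness (C3), and (C5) is the image
    of [x' + L(x, y)] under the bijection for [x]. *)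

Local Open Scope classical_set_scope.

Section EffectAlgebraTheory.
Variables (E : Type) (add : E -> E -> option E) (compl : E -> E) (zero one : E).
Hypothesis hE : effect_algebra add compl zero one.

Local Notation le := (ea_le add).
Local Notation odot := (ea_odot add compl).
Local Notation imp := (ea_imp add compl).

Lemma ea_addC x y : add x y = add y x.
Proof. exact: (ea_comm hE). Qed.

Lemma ea_add_compl x : add x (compl x) = Some one.
Proof. by case: (ea_compl hE x). Qed.

Lemma ea_compl_unique x u : add x u = Some one -> compl x = u.
Proof. by case: (ea_compl hE x) => _; apply. Qed.

Lemma ea_complK : involutive compl.
Proof. by move=> x; apply: ea_compl_unique; rewrite ea_addC ea_add_compl. Qed.

Lemma ea_compl1 : compl one = zero.
Proof. by apply: (ea_one hE); rewrite ea_add_compl. Qed.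

Lemma ea_compl0 : compl zero = one.
Proof. by rewrite -ea_compl1 ea_complK. Qed.

Lemma ea_addA x y z s t :
  add x y = Some s -> add s z = Some t -> exists2 r, add y z = Some r & add x r = Some t.
Proof.
move=> xy sz; have := ea_assoc hE x y z; rewrite xy /= sz.
by case: (add y z) => //= r xr; exists r.
Qed.

Lemma ea_addAr x y z r t :
  add y z = Some r -> add x r = Some t -> exists2 s, add x y = Some s & add s z = Some t.
Proof.
move=> yz xr; have := ea_assoc hE x y z; rewrite yz /= xr.
by case: (add x y) => //= s sz; exists s.
Qed.

Lemma ea_add0 x : add x zero = Some x.
Proof.
have one0 : add one zero = Some one by rewrite -ea_compl1 ea_add_compl.
have cx : add (compl x) x = Some one by rewrite ea_addC ea_add_compl.
have [w -> /ea_compl_unique] := ea_addA cx one0.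
by rewrite ea_complK => ->.
Qed.

(** Reassociating [(y + x) + s' = 1] shows that [x + s'] is the complement of [y]. Cancellation, the
    criterion for definedness, antitonicity of the complement and the description of [odot] all come
    from this rotation. *)
Lemma ea_add_rot x y s : add x y = Some s -> add x (compl s) = Some (compl y).
Proof.
rewrite ea_addC => yx.
by have [t -> /ea_compl_unique ->] := ea_addA yx (ea_add_compl s).
Qed.

Lemma ea_addI x y z s : add x y = Some s -> add x z = Some s -> y = z.
Proof.
move=> /ea_add_rot xy /ea_add_rot; rewrite xy => -[yz].
by rewrite -(ea_complK y) yz ea_complK.
Qed.

Lemma ea_add_definedP x y : isSome (add x y) <-> le x (compl y).
Proof.
split=> [|[z /ea_add_rot]]; last by rewrite ea_complK => ->.
by case xy: (add x y) => [s|] // _; exists (compl s); apply: ea_add_rot.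
Qed.

Lemma ea_le_refl x : le x x.
Proof. by exists zero; apply: ea_add0. Qed.

Lemma ea_le_trans y x z : le x y -> le y z -> le x z.
Proof. by move=> [u xu] [v yv]; have [w _ xw] := ea_addA xu yv; exists w. Qed.

Lemma ea_le0x x : le zero x.
Proof. by exists x; rewrite ea_addC ea_add0. Qed.

Lemma ea_lex1 x : le x one.
Proof. by exists (compl x); apply: ea_add_compl. Qed.

Lemma ea_lex0 x : le x zero -> x = zero.
Proof.
(* As [0 = 1'], the hypothesis says that [x + 1] is defined, so (E4) applies. *)
rewrite -ea_compl1 => /ea_add_definedP; rewrite ea_addC ea_compl1.
exact: (ea_one hE).
Qed.

(** From [x + (u + v) = x], cancellation gives [u + v = 0]; hence [u <= 0], so [u = 0]. *)
Lemma ea_le_antisym x y : le x y -> le y x -> x = y.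
Proof.
move=> [u xu] [v yv]; have [w uv xw] := ea_addA xu yv.
have w0 := ea_addI xw (ea_add0 x).
have u0 : u = zero by apply: ea_lex0; exists v; rewrite uv w0.
by move: xu; rewrite u0 ea_add0 => -[].
Qed.

Lemma ea_le_compl x y : le x y -> le (compl y) (compl x).
Proof.
move=> [z]; rewrite ea_addC => /ea_add_rot; rewrite ea_addC => yz.
by exists z.
Qed.

(** The same difference [c] witnesses both inequalities; the backward direction cancels [x] in
    [x + (y + c) = x + z]. *)
Lemma ea_le_add2lP x y z s t :
  add x y = Some s -> add x z = Some t -> le y z <-> le s t.
Proof.
move=> xy xz; split=> [[c yc]|[c sc]].
  have [s' ] := ea_addAr yc xz.
  by rewrite xy => -[<-] sc; exists c.
have [r yc xr] := ea_addA xy sc.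
by exists c; rewrite yc (ea_addI xr xz).
Qed.

Lemma ea_odotP x y w : odot x y = Some w <-> add (compl y) w = Some x.
Proof.
rewrite /ea_odot ea_addC; split.
  case yx: (add _ _) => [s|] //= -[<-].
  by rewrite (ea_add_rot yx) ea_complK.
by move=> /ea_add_rot -> /=; rewrite ea_complK.
Qed.

Lemma ea_odotC x y : odot x y = odot y x.
Proof. by rewrite /ea_odot ea_addC. Qed.

(** Once double complements cancel, the two sides are the complements of the two bracketings of
    [x' + y' + z']. *)
Lemma ea_odotA : partial_associative odot.
Proof.
move=> x y z; rewrite /ea_odot.
have := ea_assoc hE (compl x) (compl y) (compl z).
case: (add (compl x) _) => [s|]; case: (add (compl y) _) => [t|] //=;
  rewrite ?ea_complK.
- by move=> ->.
- by move=> ->.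
- by move=> <-.
Qed.

Lemma ea_odot1 x : odot x one = Some x.
Proof. by apply/ea_odotP; rewrite ea_compl1 ea_addC ea_add0. Qed.

Lemma ea_odot_definedP x y : isSome (odot x y) <-> le (compl x) y.
Proof.
rewrite -{2}(ea_complK y); split=> [xy|/ea_add_definedP].
  by apply/ea_add_definedP; move: xy; rewrite /ea_odot; case: (add _ _).
by rewrite /ea_odot; case: (add _ _).
Qed.

Lemma ea_odot_exists x y : le (compl y) x -> exists w, odot x y = Some w.
Proof.
move=> /ea_odot_definedP; rewrite ea_odotC.
by case: (odot x y) => // w _; exists w.
Qed.

Lemma ea_le_odot2r x y z :
  le (compl z) x -> le x y ->
  exists u v, [/\ odot x z = Some u, odot y z = Some v & le u v].
Proof.
move=> zx xy; have [u xz] := ea_odot_exists zx.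
have [v yz] := ea_odot_exists (ea_le_trans zx xy).
exists u, v; split=> //.
by move: xz yz => /ea_odotP xz /ea_odotP yz; apply/(ea_le_add2lP xz yz).
Qed.

Lemma ea_odot_sectional x y : le x y ->
  obind (fun w => odot y (compl w)) (odot y (compl x)) = Some x.
Proof.
move=> xy; have [|w] := @ea_odot_exists y (compl x); first by rewrite ea_complK.
(* Here [w] is the difference given by [x + w = y]; rotation yields [y' + x = w'], which means
   [w' ⊙ y = x]. *)
move=> yx; rewrite yx /= ea_odotC; apply/ea_odotP.
by move/ea_odotP: yx; rewrite ea_complK => /ea_add_rot; rewrite ea_addC.
Qed.

(** Both inclusions range over the same pairs, [a] in [U(x, y')] and [u] in [L(y, z)]: one asks for
    [u <= a ⊙ y], the other for [y' + u <= a]. These agree because [y' + (a ⊙ y) = a]. *)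
Lemma ea_odot_adjoint x y z :
  pimage (odot ^~ y) (upper le [set x; compl y])
    `<=` upper le (lower le [set y; z])
  <-> upper le [set x; compl y] `<=` upper le (imp y z).
Proof.
split=> H a.
  move=> aU s [u uL yu].
  have [|w aw] := @ea_odot_exists a y; first by apply: aU; right.
  have /ea_odotP yw := aw.
  by apply/(ea_le_add2lP yu yw)/H => //; exists a.
move=> [b bU /ea_odotP ya] u uL.
(* The sum exists because [u <= y = y'']. *)
have : isSome (add (compl y) u).
  by rewrite ea_addC; apply/ea_add_definedP; rewrite ea_complK; apply: uL; left.
case yu: (add _ u) => [s|] // _.
by apply/(ea_le_add2lP yu ya)/(H _ bU); exists u.
Qed.

Lemma ea_imp0 x : imp x zero = [set compl x].
Proof.
apply/seteqP; split=> [s [u uL]|_ ->].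
  (* The set [L(x, 0)] contains only [0]. *)
  have -> : u = zero by apply/ea_lex0/uL; right.
  by rewrite ea_add0 => -[].
exists zero; last exact: ea_add0.
by move=> a _; apply: ea_le0x.
Qed.

(** Multiplying by [x] undoes adding [x']; both parts of divisibility, definedness and the value of
    the image, rest on this. *)
Lemma ea_odot_addl x u s : add (compl x) u = Some s -> odot x s = Some u.
Proof. by rewrite ea_odotC => /ea_odotP. Qed.

Lemma ea_odot_imp_defined x y : defined_on (odot x) (imp x y).
Proof. by move=> s [u _ /ea_odot_addl ->]. Qed.

Lemma ea_odot_imp x y : pimage (odot x) (imp x y) = lower le [set x; y].
Proof.
apply/seteqP; split=> [w [s [u uL /ea_odot_addl ->]] [<-] //|u uL].
have : isSome (add (compl x) u).
  by rewrite ea_addC; apply/ea_add_definedP; rewrite ea_complK; apply: uL; left.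
case xu: (add _ u) => [s|] // _.
by exists s; [exists u | apply: ea_odot_addl].
Qed.

End EffectAlgebraTheory.

Theorem theorem7 (E : Type) (add : E -> E -> option E) (compl : E -> E)
    (zero one : E) (hE : effect_algebra add compl zero one) :
  divisible_strict_unsharp_residuated_poset (ea_le add) (ea_odot add compl)
    (ea_imp add compl) compl zero one.
Proof.
split; last 2 first.
- by move=> x y; apply: (ea_odot_imp_defined hE).
- by move=> x y; apply: (ea_odot_imp hE).
split.
- split.
  + split.
    * exact: (ea_le_refl hE).
    * by move=> x y z; apply: (ea_le_trans hE).
    * exact: (ea_le_antisym hE).
  + exact: (ea_le0x hE).
  + exact: (ea_lex1 hE).
  + by move=> x y; apply: (ea_le_compl hE).
  + exact: (ea_complK hE).
- split.
  + exact: (ea_odotA hE).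
  + exact: (ea_odot1 hE).
  + by move=> x; rewrite (ea_odotC hE) (ea_odot1 hE).
  + exact: (ea_odotC hE).
- exact: (ea_odot_definedP hE).
- exact: (ea_le_odot2r hE).
- exact: (ea_odot_sectional hE).
- exact: (ea_odot_adjoint hE).
- exact: (ea_imp0 hE).
Qed.
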